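(* Let $\mathcal C$ be a homological category and let $L\colon\mathcal C\to\mathcal C$ be a localization functor such that every coaugmentation morphism $\eta_X\colon X\to L(X)$ is a normal epimorphism. Then the following conditions are equivalent: (0) $\mathcal C$ admits functorial fiberwise localization with respect to $L$; (1) for any normal monomorphism $k\colon K\to E$ in $\mathcal C$, the pushout of $k$ along $\eta_K$ exists, $$\begin{array}{ccc} K & \xrightarrow{\;k\;} & E\\ {\scriptstyle \eta_K}\downarrow & & \downarrow\\ L(K) & \xrightarrow{\;\overline k\;} & \overline E\end{array}$$ and this square is also a pullback; (2) for any normal monomorphism $k\colon K\to E$ in $\mathcal C$, the pushout of $k$ along $\eta_K$ (as in the square above) exists and the morphism $\overline k\colon L(K)\to\overline E$ is a monomorphism.
   Context: A category is regular if it is finitely complete, every morphism factors as a regular epimorphism followed by a monomorphism, and regular epimorphisms are stable under pullback. A homological category is a pointed regular category (zero object $0$) in which the Split Short Five Lemma holds: for any morphism $(u,v,w)$ between split epimorphisms (with chosen kernels, and compatible with the splittings), $u\colon K\to K'$ on kernels, $v\colon A\to A'$, $w\colon B\to B'$, if $u$ and $w$ are isomorphisms then so is $v$. A normal epimorphism is a cokernel of some morphism; a normal monomorphism is a kernel of some morphism. A localization functor is an idempotent pointed endofunctor: a functor $L\colon\mathcal C\to\mathcal C$ with a natural transformation $\eta\colon 1_{\mathcal C}\Rightarrow L$ (the coaugmentation) such that $L\eta=\eta L\colon L\to LL$ and this is an isomorphism. An extension in $\mathcal C$ is a short exact sequence $0\to K\to E\to Q\to 0$ (the first map is a kernel of the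 second, the second is a cokernel of the first). An extension $0\to K\to E\to Q\to 0$ admits a fiberwise localization (with respect to $L$) if there is an extension $0\to L(K)\to\overline E\to Q\to 0$ and a morphism $e\colon E\to\overline E$ inverted by $L$ (i.e. $L(e)$ is an isomorphism) such that $(\eta_K,e,1_Q)$ is a morphism of extensions. The category $\mathcal C$ admits functorial fiberwise localization with respect to $L$ if every extension is assigned a fiberwise localization in a functorial way: every morphism of extensions $(u,v,w)$ from $0\to K\to E\to Q\to 0$ to $0\to K'\to E'\to Q'\to 0$ is assigned a morphism $\overline v\colon\overline E\to\overline{E'}$ such that $(L(u),\overline v,w)$ is a morphism between the fiberwise localized extensions and $\overline v\circ e=e'\circ v$, and this assignment preserves identities and composition. *)

(* Defs.v *)
From Stdlib Require Import FinFun.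

Set Implicit Arguments.
Unset Strict Implicit.
Unset Printing Implicit Defensive.

Declare Scope cat_scope.
Delimit Scope cat_scope with cat.

(* [comp g f] is "g after f". *)
Record Category : Type := {
  Obj :> Type;
  Hom : Obj -> Obj -> Type;
  idm : forall X : Obj, Hom X X;
  comp : forall X Y Z : Obj, Hom Y Z -> Hom X Y -> Hom X Z;
  comp_id_l : forall (X Y : Obj) (f : Hom X Y), comp (idm Y) f = f;
  comp_id_r : forall (X Y : Obj) (f : Hom X Y), comp f (idm X) = f;
  comp_assoc : forall (W X Y Z : Obj) (h : Hom Y Z) (g : Hom X Y) (f : Hom W X),
    comp h (comp g f) = comp (comp h g) f
}.

Arguments Hom {_} _ _.
Arguments idm {_} _.
Arguments comp {_} {_ _ _} _ _.

Notation "g ∘ f" := (comp g f) (at level 40, left associativity) : cat_scope.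
Open Scope cat_scope.

Record Functor (C D : Category) : Type := {
  fobj :> C -> D;
  fmap : forall X Y : C, Hom X Y -> Hom (fobj X) (fobj Y);
  fmap_id : forall X : C, fmap (idm X) = idm (fobj X);
  fmap_comp : forall (X Y Z : C) (g : Hom Y Z) (f : Hom X Y),
    fmap (g ∘ f) = fmap g ∘ fmap f
}.

Arguments fmap {_ _} _ {_ _} _.

Definition is_iso (C : Category) (X Y : C) (f : Hom X Y) : Prop :=
  exists g : Hom Y X, g ∘ f = idm X /\ f ∘ g = idm Y.

Definition is_mono (C : Category) (X Y : C) (f : Hom X Y) : Prop :=
  forall (W : C) (a b : Hom W X), f ∘ a = f ∘ b -> a = b.

Definition is_limit (J C : Category) (D : Functor J C) (P : C)
    (p : forall j : J, Hom P (D j)) : Prop :=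
  (forall (i j : J) (a : Hom i j), fmap D a ∘ p i = p j) /\
  (forall (X : C) (x : forall j : J, Hom X (D j)),
     (forall (i j : J) (a : Hom i j), fmap D a ∘ x i = x j) ->
     exists! h : Hom X P, forall j : J, p j ∘ h = x j).

Definition finite_category (J : Category) : Prop :=
  Finite J /\ forall i j : J, Finite (Hom i j).

Definition finitely_complete (C : Category) : Prop :=
  forall J : Category, finite_category J ->
  forall D : Functor J C,
  exists (P : C) (p : forall j : J, Hom P (D j)), is_limit p.

(*        p2
      P ----> B
   p1 |       | g
      v       v
      A ----> S
          f          *)
Definition is_pullback (C : Category) (A B S P : C)
    (f : Hom A S) (g : Hom B S) (p1 : Hom P A) (p2 : Hom P B) : Prop :=
  f ∘ p1 = g ∘ p2 /\
  forall (X : C) (a : Hom X A) (b : Hom X B), f ∘ a = g ∘ b ->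
  exists! h : Hom X P, p1 ∘ h = a /\ p2 ∘ h = b.

(*        g
      S ----> B
    f |       | i2
      v       v
      A ----> P
          i1         *)
Definition is_pushout (C : Category) (S A B P : C)
    (f : Hom S A) (g : Hom S B) (i1 : Hom A P) (i2 : Hom B P) : Prop :=
  i1 ∘ f = i2 ∘ g /\
  forall (X : C) (a : Hom A X) (b : Hom B X), a ∘ f = b ∘ g ->
  exists! h : Hom P X, h ∘ i1 = a /\ h ∘ i2 = b.

Definition is_coequalizer (C : Category) (R X Y : C)
    (a b : Hom R X) (f : Hom X Y) : Prop :=
  f ∘ a = f ∘ b /\
  forall (Z : C) (g : Hom X Z), g ∘ a = g ∘ b ->
  exists! h : Hom Y Z, h ∘ f = g.

Definition regular_epi (C : Category) (X Y : C) (f : Hom X Y) : Prop :=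
  exists (R : C) (a b : Hom R X), is_coequalizer a b f.

Definition regular (C : Category) : Prop :=
  finitely_complete C /\
  (forall (X Y : C) (f : Hom X Y),
     exists (I : C) (p : Hom X I) (m : Hom I Y),
       regular_epi p /\ is_mono m /\ f = m ∘ p) /\
  (forall (A B S P : C) (f : Hom A S) (g : Hom B S) (p1 : Hom P A) (p2 : Hom P B),
     is_pullback f g p1 p2 -> regular_epi g -> regular_epi p1).

Definition is_zero_object (C : Category) (Z : C) : Prop :=
  (forall X : C, exists! f : Hom X Z, True) /\
  (forall X : C, exists! f : Hom Z X, True).

Definition pointed (C : Category) : Prop :=
  exists Z : C, is_zero_object Z.

Definition is_zero (C : Category) (X Y : C) (f : Hom X Y) : Prop :=
  exists (Z : C) (a : Hom X Z) (b : Hom Z Y), is_zero_object Z /\ f = b ∘ a.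

Definition is_kernel (C : Category) (K X Y : C) (k : Hom K X) (f : Hom X Y) : Prop :=
  is_zero (f ∘ k) /\
  forall (W : C) (g : Hom W X), is_zero (f ∘ g) ->
  exists! h : Hom W K, k ∘ h = g.

Definition is_cokernel (C : Category) (X Y Q : C) (q : Hom Y Q) (f : Hom X Y) : Prop :=
  is_zero (q ∘ f) /\
  forall (W : C) (g : Hom Y W), is_zero (g ∘ f) ->
  exists! h : Hom Q W, h ∘ q = g.

Definition normal_mono (C : Category) (K X : C) (k : Hom K X) : Prop :=
  exists (Y : C) (f : Hom X Y), is_kernel k f.

Definition normal_epi (C : Category) (Y Q : C) (q : Hom Y Q) : Prop :=
  exists (X : C) (f : Hom X Y), is_cokernel q f.

Definition split_short_five_lemma (C : Category) : Prop :=
  forall (K A B K' A' B' : C)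
    (k : Hom K A) (p : Hom A B) (s : Hom B A)
    (k' : Hom K' A') (p' : Hom A' B') (s' : Hom B' A')
    (u : Hom K K') (v : Hom A A') (w : Hom B B'),
  p ∘ s = idm B -> is_kernel k p ->
  p' ∘ s' = idm B' -> is_kernel k' p' ->
  v ∘ k = k' ∘ u -> p' ∘ v = w ∘ p -> v ∘ s = s' ∘ w ->
  is_iso u -> is_iso w -> is_iso v.

Definition homological (C : Category) : Prop :=
  pointed C /\ regular C /\ split_short_five_lemma C.

(* "Pointed" endofunctor refers to the coaugmentation only; preservation of the
   zero object is not part of the structure. *)
Record LocalizationFunctor (C : Category) : Type := {
  loc :> Functor C C;
  coaug : forall X : C, Hom X (loc X);
  coaug_natural : forall (X Y : C) (f : Hom X Y),
    coaug Y ∘ f = fmap loc f ∘ coaug X;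
  loc_coaug : forall X : C, fmap loc (coaug X) = coaug (loc X);
  loc_coaug_iso : forall X : C, is_iso (fmap loc (coaug X))
}.

Arguments coaug {_} _ _.

Definition short_exact (C : Category) (K E Q : C) (k : Hom K E) (q : Hom E Q) : Prop :=
  is_kernel k q /\ is_cokernel q k.

Definition is_ext_mor (C : Category) (K E Q K' E' Q' : C)
    (k : Hom K E) (q : Hom E Q) (k' : Hom K' E') (q' : Hom E' Q')
    (u : Hom K K') (v : Hom E E') (w : Hom Q Q') : Prop :=
  v ∘ k = k' ∘ u /\ q' ∘ v = w ∘ q.

Record Extension (C : Category) : Type := {
  extK : C;
  extE : C;
  extQ : C;
  extk : Hom extK extE;
  extq : Hom extE extQ;
  ext_exact : short_exact extk extq
}.

Arguments extk {_} _.
Arguments extq {_} _.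

Record ExtMor (C : Category) (X Y : Extension C) : Type := {
  mor_u : Hom (extK X) (extK Y);
  mor_v : Hom (extE X) (extE Y);
  mor_w : Hom (extQ X) (extQ Y);
  mor_comm : is_ext_mor (extk X) (extq X) (extk Y) (extq Y) mor_u mor_v mor_w
}.

Lemma is_ext_mor_id (C : Category) (X : Extension C) :
  is_ext_mor (extk X) (extq X) (extk X) (extq X)
    (idm (extK X)) (idm (extE X)) (idm (extQ X)).
Proof. split; rewrite comp_id_l, comp_id_r; reflexivity. Qed.

Lemma is_ext_mor_comp (C : Category) (X Y Z : Extension C)
    (g : ExtMor Y Z) (f : ExtMor X Y) :
  is_ext_mor (extk X) (extq X) (extk Z) (extq Z)
    (mor_u g ∘ mor_u f) (mor_v g ∘ mor_v f) (mor_w g ∘ mor_w f).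
Proof.
destruct (mor_comm f) as [f1 f2]; destruct (mor_comm g) as [g1 g2]; split.
- rewrite <- comp_assoc, f1, comp_assoc, g1, comp_assoc; reflexivity.
- rewrite comp_assoc, g2, <- comp_assoc, f2, comp_assoc; reflexivity.
Qed.

Definition ext_id (C : Category) (X : Extension C) : ExtMor X X :=
  {| mor_comm := is_ext_mor_id X |}.

Definition ext_comp (C : Category) (X Y Z : Extension C)
    (g : ExtMor Y Z) (f : ExtMor X Y) : ExtMor X Z :=
  {| mor_comm := is_ext_mor_comp g f |}.

Record FiberwiseLocalization (C : Category) (L : LocalizationFunctor C)
    (X : Extension C) : Type := {
  flE : C;
  flk : Hom (L (extK X)) flE;
  flq : Hom flE (extQ X);
  fle : Hom (extE X) flE;
  fl_exact : short_exact flk flq;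
  fl_inverted : is_iso (fmap L fle);
  fl_comm : is_ext_mor (extk X) (extq X) flk flq
              (coaug L (extK X)) fle (idm (extQ X))
}.

Arguments flk {_ _ _} _.
Arguments flq {_ _ _} _.
Arguments fle {_ _ _} _.

Record FunctorialFiberwiseLocalization (C : Category)
    (L : LocalizationFunctor C) : Type := {
  ffl : forall X : Extension C, FiberwiseLocalization L X;
  ffl_map : forall X Y : Extension C, ExtMor X Y -> Hom (flE (ffl X)) (flE (ffl Y));
  ffl_comm : forall (X Y : Extension C) (f : ExtMor X Y),
    is_ext_mor (flk (ffl X)) (flq (ffl X)) (flk (ffl Y)) (flq (ffl Y))
      (fmap L (mor_u f)) (ffl_map f) (mor_w f);
  ffl_natural : forall (X Y : Extension C) (f : ExtMor X Y),
    ffl_map f ∘ fle (ffl X) = fle (ffl Y) ∘ mor_v f;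
  ffl_id : forall X : Extension C, ffl_map (ext_id X) = idm (flE (ffl X));
  ffl_comp : forall (X Y Z : Extension C) (g : ExtMor Y Z) (f : ExtMor X Y),
    ffl_map (ext_comp g f) = ffl_map g ∘ ffl_map f
}.

Definition admits_functorial_fiberwise_localization (C : Category)
    (L : LocalizationFunctor C) : Prop :=
  inhabited (FunctorialFiberwiseLocalization L).

Definition pushouts_exist_and_are_pullbacks (C : Category)
    (L : LocalizationFunctor C) : Prop :=
  forall (K E : C) (k : Hom K E), normal_mono k ->
  exists (Eb : C) (e : Hom E Eb) (kb : Hom (L K) Eb),
    is_pushout k (coaug L K) e kb /\ is_pullback e kb k (coaug L K).

Definition pushouts_exist_with_mono (C : Category)
    (L : LocalizationFunctor C) : Prop :=
  forall (K E : C) (k : Hom K E), normal_mono k ->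
  exists (Eb : C) (e : Hom E Eb) (kb : Hom (L K) Eb),
    is_pushout k (coaug L K) e kb /\ is_mono kb.

(* Main.v *)
(** The horizontal identity [1_Q] makes the left square of a fiberwise
    localization a pullback for free, and protomodularity makes it a pushout: the
    image of [e] is a subobject of [Eb] containing [L K] and mapping onto [Q], hence
    all of [Eb], so [e] is the cokernel of its kernel, which lies in [K].
    Conversely, when the pushout [kb] of [k] is a monomorphism, it is the kernel of
    the induced [Eb -> Q] because [e] is a regular epimorphism, and [e] is inverted
    by [L] because it is a pushout of [coaug L K]. *)

From Stdlib Require Import List ClassicalEpsilon.
Require Import Defs.

Import ListNotations.

Set Implicit Arguments.
Unset Strict Implicit.
Unset Printing Implicit Defensive.

Definition is_epi (C : Category) (X Y : C) (f : Hom X Y) : Prop :=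
  forall (W : C) (a b : Hom Y W), a ∘ f = b ∘ f -> a = b.

(** * Pullbacks as limits over a finite category *)

Inductive cospan_obj : Type := cospan_l | cospan_r | cospan_apex.

(** Each hom-set computes to [unit] or [Empty_set], so finiteness and the category laws reduce to
    case analysis. *)
Definition cospan_hom (i j : cospan_obj) : Type :=
  match i, j with
  | cospan_l, cospan_r | cospan_r, cospan_l
  | cospan_apex, cospan_l | cospan_apex, cospan_r => Empty_set
  | _, _ => unit
  end.

Definition cospan_id (i : cospan_obj) : cospan_hom i i :=
  match i with cospan_l | cospan_r | cospan_apex => tt end.

Definition cospan_comp (i j k : cospan_obj) :
  cospan_hom j k -> cospan_hom i j -> cospan_hom i k.
Proof. destruct i, j, k; simpl; intros [] []; exact tt. Defined.

Definition cospan : Category.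
Proof.
refine {| Obj := cospan_obj; Hom := cospan_hom; idm := cospan_id;
          comp := cospan_comp |}.
- intros [] [] []; reflexivity.
- intros [] [] []; reflexivity.
- intros [] [] [] [] [] [] []; reflexivity.
Defined.

Lemma cospan_finite : finite_category cospan.
Proof.
split.
- exists [cospan_l; cospan_r; cospan_apex]; intros []; simpl; auto.
- intros [] []; simpl;
    solve [exists [tt]; intros []; simpl; auto | exists []; intros []].
Qed.

Definition cospan_fobj (C : Category) (A B S : C) (i : cospan) : C :=
  match i with cospan_l => A | cospan_r => B | cospan_apex => S end.

Definition cospan_fmap (C : Category) (A B S : C) (f : Hom A S) (g : Hom B S)
    (i j : cospan) : Hom i j -> Hom (cospan_fobj A B S i) (cospan_fobj A B S j) :=
  match i, j
  return cospan_hom i j -> Hom (cospan_fobj A B S i) (cospan_fobj A B S j) with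
  | cospan_l, cospan_l => fun _ => idm A
  | cospan_l, cospan_r => fun e => match e with end
  | cospan_l, cospan_apex => fun _ => f
  | cospan_r, cospan_l => fun e => match e with end
  | cospan_r, cospan_r => fun _ => idm B
  | cospan_r, cospan_apex => fun _ => g
  | cospan_apex, cospan_l => fun e => match e with end
  | cospan_apex, cospan_r => fun e => match e with end
  | cospan_apex, cospan_apex => fun _ => idm S
  end.

Definition cospan_functor (C : Category) (A B S : C) (f : Hom A S) (g : Hom B S) :
  Functor cospan C.
Proof.
refine {| fobj := cospan_fobj A B S; fmap := cospan_fmap f g |}.
- intros []; reflexivity.
- intros [] [] [] [] []; simpl; rewrite ?comp_id_l, ?comp_id_r; reflexivity.
Defined.

Lemma pullback_exists (C : Category) (A B S : C) (f : Hom A S) (g : Hom B S) :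
  finitely_complete C ->
  exists (P : C) (p1 : Hom P A) (p2 : Hom P B), is_pullback f g p1 p2.
Proof.
intros HC.
destruct (HC _ cospan_finite (cospan_functor f g)) as (P & p & Hp & Hu).
pose proof (Hp cospan_l cospan_apex tt) as H1.
pose proof (Hp cospan_r cospan_apex tt) as H2.
simpl in H1, H2.
exists P, (p cospan_l), (p cospan_r); split.
{ rewrite H1, H2; reflexivity. }
intros X a b Hab.
pose (x := fun j : cospan =>
  match j return Hom X (cospan_functor f g j) with
  | cospan_l => a | cospan_r => b | cospan_apex => f ∘ a end).
destruct (Hu X x) as (h & Hh & Huniq).
{ intros [] [] []; simpl; rewrite ?comp_id_l; auto. }
exists h; split.
{ split; [exact (Hh cospan_l) | exact (Hh cospan_r)]. }
intros h' [E1 E2]; apply Huniq; intros []; simpl; auto.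
rewrite <- H1, <- comp_assoc, E1; reflexivity.
Qed.

Lemma pullback_sym (C : Category) (A B S P : C) (f : Hom A S) (g : Hom B S)
    (p1 : Hom P A) (p2 : Hom P B) :
  is_pullback f g p1 p2 -> is_pullback g f p2 p1.
Proof.
intros [Hc Hu]; split; [auto |].
intros X a b E.
destruct (Hu X b a (eq_sym E)) as (h & [h1 h2] & Hh).
exists h; split; [auto |].
intros h' [E1 E2]; apply Hh; auto.
Qed.

Lemma pullback_jointly_monic (C : Category) (A B S P : C) (f : Hom A S)
    (g : Hom B S) (p1 : Hom P A) (p2 : Hom P B) :
  is_pullback f g p1 p2 ->
  forall (X : C) (a b : Hom X P), p1 ∘ a = p1 ∘ b -> p2 ∘ a = p2 ∘ b -> a = b.
Proof.
intros [Hc Hu] X a b E1 E2.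
destruct (Hu X (p1 ∘ b) (p2 ∘ b)) as (h & _ & Hh).
{ rewrite !comp_assoc, Hc; reflexivity. }
rewrite <- (Hh a) by auto; apply Hh; auto.
Qed.

(** * Zero morphisms, equalizers and kernels *)

Lemma zero_unique (C : Category) (X Y : C) (f g : Hom X Y) :
  is_zero f -> is_zero g -> f = g.
Proof.
intros (Z & a & b & [HT _] & ->) (Z' & a' & b' & [_ HI] & ->).
(* The two maps may factor through different zero objects; [w : Z' -> Z] compares the two
   factorizations. *)
destruct (HI Z) as (w & _ & _).
destruct (HT X) as (t & _ & Ht), (HI Y) as (i & _ & Hi).
assert (E1 : w ∘ a' = a) by (rewrite <- (Ht a), <- (Ht (w ∘ a')); auto).
assert (E2 : b ∘ w = b') by (rewrite <- (Hi b'), <- (Hi (b ∘ w)); auto).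
rewrite <- E1, <- E2, comp_assoc; reflexivity.
Qed.

Lemma zero_comp_l (C : Category) (X Y W : C) (f : Hom X Y) (g : Hom Y W) :
  is_zero f -> is_zero (g ∘ f).
Proof.
intros (Z & a & b & HZ & ->); exists Z, a, (g ∘ b).
rewrite comp_assoc; auto.
Qed.

Lemma zero_comp_r (C : Category) (X Y W : C) (f : Hom X Y) (g : Hom W X) :
  is_zero f -> is_zero (f ∘ g).
Proof.
intros (Z & a & b & HZ & ->); exists Z, (a ∘ g), b.
rewrite comp_assoc; auto.
Qed.

Lemma zero_exists (C : Category) (X Y : C) :
  pointed C -> exists f : Hom X Y, is_zero f.
Proof.
intros (Z & HZ); pose proof HZ as [HT HI].
destruct (HT X) as (a & _), (HI Y) as (b & _).
exists (b ∘ a), Z, a, b; auto.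
Qed.

(** Built from two pullbacks: [P] is the product of [Y] with itself, taken over the zero object, and
    [E] is the pullback of the diagonal [d] along the pairing [fg] of [f] and [g]. *)
Lemma equalizer_exists (C : Category) (X Y : C) (f g : Hom X Y) :
  pointed C -> finitely_complete C ->
  exists (E : C) (i : Hom E X), f ∘ i = g ∘ i /\ is_mono i /\
    forall (W : C) (h : Hom W X), f ∘ h = g ∘ h -> exists t : Hom W E, i ∘ t = h.
Proof.
intros [Z HZ] HC; pose proof HZ as [HT _].
destruct (HT Y) as (z & _ & _).
destruct (pullback_exists z z HC) as (P & p1 & p2 & HP).
assert (Hz : forall (W : C) (a b : Hom W Y), z ∘ a = z ∘ b).
{ intros W a b; destruct (HT W) as (t & _ & Ht).
  rewrite <- (Ht (z ∘ a)), <- (Ht (z ∘ b)); auto. }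
destruct (proj2 HP X f g (Hz _ _ _)) as (fg & [F1 F2] & _).
destruct (proj2 HP Y (idm Y) (idm Y) (Hz _ _ _)) as (d & [D1 D2] & _).
destruct (pullback_exists fg d HC) as (E & i & j & HE).
pose proof (proj1 HE) as HEc.
assert (J1 : f ∘ i = j).
{ rewrite <- F1, <- comp_assoc, HEc, comp_assoc, D1, comp_id_l; reflexivity. }
assert (J2 : g ∘ i = j).
{ rewrite <- F2, <- comp_assoc, HEc, comp_assoc, D2, comp_id_l; reflexivity. }
exists E, i; repeat split.
- rewrite J1, J2; reflexivity.
- intros W a b Hab; apply (pullback_jointly_monic HE); [exact Hab |].
  rewrite <- J1, <- !comp_assoc, Hab; reflexivity.
- intros W h Hh.
  destruct (proj2 HE W h (f ∘ h)) as (t & [T1 _] & _).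
  { apply (pullback_jointly_monic HP).
    - rewrite !comp_assoc, F1, D1, comp_id_l; reflexivity.
    - rewrite !comp_assoc, F2, D2, comp_id_l; auto. }
  exists t; exact T1.
Qed.

Lemma kernel_exists (C : Category) (X Y : C) (f : Hom X Y) :
  pointed C -> finitely_complete C ->
  exists (K : C) (k : Hom K X), is_kernel k f.
Proof.
intros HP HC.
destruct (zero_exists X Y HP) as (z & Hz).
destruct (equalizer_exists f z HP HC) as (K & k & E & Hm & Hu).
exists K, k; split.
{ rewrite E; apply zero_comp_r; exact Hz. }
intros W g Hg.
destruct (Hu W g) as (t & Ht).
{ apply zero_unique; [exact Hg | apply zero_comp_r; exact Hz]. }
exists t; split; [exact Ht |].
intros t' Ht'; apply Hm; rewrite Ht, Ht'; reflexivity.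
Qed.

Lemma kernel_mono (C : Category) (K X Y : C) (k : Hom K X) (f : Hom X Y) :
  is_kernel k f -> is_mono k.
Proof.
intros [Hz Hu] W a b E.
destruct (Hu W (k ∘ b)) as (h & _ & Hh).
{ rewrite comp_assoc; apply zero_comp_r; exact Hz. }
rewrite <- (Hh a E); apply Hh; reflexivity.
Qed.

Lemma kernel_restrict (C : Category) (K I X Y : C) (k : Hom K I) (i : Hom I X)
    (f : Hom X Y) :
  is_mono i -> is_kernel (i ∘ k) f -> is_kernel k (f ∘ i).
Proof.
intros Hi HK; pose proof HK as [Hz Hu]; split.
{ rewrite <- comp_assoc; exact Hz. }
intros W g Hg.
destruct (Hu W (i ∘ g)) as (h & Eh & Hh).
{ rewrite comp_assoc; exact Hg. }
rewrite <- comp_assoc in Eh.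
exists h; split; [apply Hi; exact Eh |].
intros h' <-; apply Hh; rewrite comp_assoc; reflexivity.
Qed.

(** The lift [k'] is the pair of [k] and zero. Both kernels have the same domain [K], so the Split
    Short Five Lemma can be applied with the identity on kernels. *)
Lemma kernel_pullback (C : Category) (K A B S P : C) (k : Hom K A) (f : Hom A S)
    (g : Hom B S) (p1 : Hom P A) (p2 : Hom P B) :
  pointed C -> is_pullback f g p1 p2 -> is_kernel k f ->
  exists k' : Hom K P, p1 ∘ k' = k /\ is_kernel k' p2.
Proof.
intros Hpt HP HK; pose proof HK as [Hz Hu].
destruct (zero_exists K B Hpt) as (z & Zz).
destruct (proj2 HP K k z) as (k' & [E1 E2] & _).
{ apply zero_unique; [exact Hz | apply zero_comp_l; exact Zz]. }
exists k'; split; [exact E1 |]; split; [rewrite E2; exact Zz |].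
intros W h Hh.
destruct (Hu W (p1 ∘ h)) as (t & Et & _).
{ rewrite comp_assoc, (proj1 HP), <- comp_assoc.
  apply zero_comp_l; exact Hh. }
assert (Eth : k' ∘ t = h).
{ apply (pullback_jointly_monic HP).
  - rewrite comp_assoc, E1; exact Et.
  - apply zero_unique; [| exact Hh].
    rewrite comp_assoc, E2; apply zero_comp_r; exact Zz. }
exists t; split; [exact Eth |].
intros t' Et'; apply (kernel_mono HK).
rewrite <- E1, <- !comp_assoc, Eth, Et'; reflexivity.
Qed.

(** * Regular and normal epimorphisms *)

Lemma regular_epi_epi (C : Category) (X Y : C) (f : Hom X Y) :
  regular_epi f -> is_epi f.
Proof.
intros (R & a & b & Hc & Hu) W x y E.
destruct (Hu W (y ∘ f)) as (h & _ & Hh).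
{ rewrite <- !comp_assoc, Hc; reflexivity. }
rewrite <- (Hh x E); apply Hh; reflexivity.
Qed.

(** A cokernel of [g] is a coequalizer of [g] and the zero map. *)
Lemma normal_epi_regular (C : Category) (X Y : C) (f : Hom X Y) :
  pointed C -> normal_epi f -> regular_epi f.
Proof.
intros HP (W & g & Hz & Hu).
destruct (zero_exists W X HP) as (z & Zz).
exists W, g, z; split.
{ apply zero_unique; [exact Hz | apply zero_comp_l; exact Zz]. }
intros V h Hh; apply Hu; rewrite Hh; apply zero_comp_l; exact Zz.
Qed.

Lemma regular_epi_lift (C : Category) (X Y A B : C) (r : Hom X Y) (m : Hom A B)
    (a : Hom X A) (b : Hom Y B) :
  regular_epi r -> is_mono m -> m ∘ a = b ∘ r ->
  exists t : Hom Y A, m ∘ t = b /\ t ∘ r = a.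
Proof.
intros Hr Hm E; pose proof Hr as (R & x & y & Hc & Hu).
destruct (Hu A a) as (t & Ht & _).
{ apply Hm; rewrite !comp_assoc, E, <- !comp_assoc, Hc; reflexivity. }
exists t; split; [| exact Ht].
apply (regular_epi_epi Hr); rewrite <- comp_assoc, Ht; exact E.
Qed.

(** Lifting the identity of [B] against [m] gives a section of [m], and a monomorphism with a
    section is invertible. *)
Lemma mono_iso_of_regular_epi (C : Category) (X A B : C) (m : Hom A B)
    (x : Hom X A) :
  is_mono m -> regular_epi (m ∘ x) -> is_iso m.
Proof.
intros Hm Hr.
destruct (@regular_epi_lift _ _ _ _ _ (m ∘ x) m x (idm B) Hr Hm) as (t & Ht & _).
{ rewrite comp_id_l; reflexivity. }
exists t; split; [| exact Ht].
apply Hm; rewrite comp_assoc, Ht, comp_id_l, comp_id_r; reflexivity.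
Qed.

Lemma regular_epi_iso_comp (C : Category) (X A B : C) (m : Hom A B) (p : Hom X A) :
  is_iso m -> regular_epi p -> regular_epi (m ∘ p).
Proof.
intros (n & Hn1 & Hn2) (R & a & b & Hc & Hu).
exists R, a, b; split.
{ rewrite <- !comp_assoc, Hc; reflexivity. }
intros Z g Hg; destruct (Hu Z g Hg) as (h & Eh & Hh).
exists (h ∘ n); split.
{ rewrite <- comp_assoc, (comp_assoc n), Hn1, comp_id_l; exact Eh. }
intros h' E'; rewrite (Hh (h' ∘ m)).
- rewrite <- comp_assoc, Hn2, comp_id_r; reflexivity.
- rewrite <- comp_assoc; exact E'.
Qed.

(** * Consequences of the Split Short Five Lemma *)

Lemma id_iso (C : Category) (X : C) : is_iso (idm X).
Proof. exists (idm X); split; apply comp_id_l. Qed.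

(* The kernel pair of [f] is generated by its diagonal and by [(0, k)], so
   killing [k] suffices to coequalize it. *)
Lemma regular_epi_cokernel (C : Category) (K X Y : C) (k : Hom K X) (f : Hom X Y) :
  homological C -> regular_epi f -> is_kernel k f -> is_cokernel f k.
Proof.
intros (Hpt & (Hfc & _) & H5) Hr HK; split; [exact (proj1 HK) |].
intros W g Hg.
destruct (pullback_exists f f Hfc) as (R & r1 & r2 & HR).
(* [c] is the pair [(0, k)], a kernel of [r1]; the diagonal [s] of the next line splits [r1]. *)
destruct (kernel_pullback Hpt (pullback_sym HR) HK) as (c & Ec & Hc).
destruct (proj2 HR X (idm X) (idm X) eq_refl) as (s & [S1 S2] & _).
(* [E] is the part of the kernel pair on which [g] agrees. It contains both [s] and [c], so the
   Split Short Five Lemma over [X] forces [i : E -> R] to be an isomorphism. *)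
destruct (equalizer_exists (g ∘ r1) (g ∘ r2) Hpt Hfc) as (E & i & Ei & Hi & Hu).
destruct (Hu X s) as (s' & Es').
{ rewrite <- !comp_assoc, S1, S2; reflexivity. }
destruct (Hu K c) as (c' & Ec').
{ rewrite <- !comp_assoc, Ec.
  apply zero_unique; [apply zero_comp_l; exact (proj1 Hc) | exact Hg]. }
assert (Hiso : is_iso i).
{ apply (H5 K E X K R X c' (r1 ∘ i) s' c r1 s (idm K) i (idm X)).
  - rewrite <- comp_assoc, Es'; exact S1.
  - apply kernel_restrict; [exact Hi | rewrite Ec'; exact Hc].
  - exact S1.
  - exact Hc.
  - rewrite Ec', comp_id_r; reflexivity.
  - rewrite comp_id_l; reflexivity.
  - rewrite Es', comp_id_r; reflexivity.
  - apply id_iso.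
  - apply id_iso. }
destruct Hiso as (n & _ & Hn).
assert (Egr : g ∘ r1 = g ∘ r2).
{ rewrite <- (comp_id_r (g ∘ r1)), <- (comp_id_r (g ∘ r2)), <- Hn, !comp_assoc, Ei.
  reflexivity. }
destruct Hr as (T & a & b & Hab & Hcoeq).
apply Hcoeq.
destruct (proj2 HR T a b Hab) as (h & [<- <-] & _).
rewrite !comp_assoc, Egr; reflexivity.
Qed.

(** [q] and [q ∘ m] have the same kernel object [K] but need not split. Base change along
    [q ∘ m ∘ x] gives both a section while keeping the kernels, so the Split Short Five Lemma
    applies upstairs. *)
Lemma mono_iso_of_kernel (C : Category) (K I E Q X : C) (j : Hom K I)
    (m : Hom I E) (q : Hom E Q) (x : Hom X I) :
  homological C -> is_mono m -> is_kernel (m ∘ j) q -> regular_epi (q ∘ m ∘ x) ->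
  is_iso m.
Proof.
intros (Hpt & (Hfc & _ & Hst) & H5) Hm HK Hr.
destruct (pullback_exists (q ∘ m) (q ∘ m ∘ x) Hfc) as (P1 & a1 & b1 & HP1).
destruct (pullback_exists q (q ∘ m ∘ x) Hfc) as (P2 & a2 & b2 & HP2).
destruct (kernel_pullback Hpt HP1 (kernel_restrict Hm HK)) as (k1 & Ek1 & Hk1).
destruct (kernel_pullback Hpt HP2 HK) as (k2 & Ek2 & Hk2).
(* The sections are [(x, 1)] and [(m ∘ x, 1)]; [v], induced by [m], respects them. *)
destruct (proj2 HP1 X x (idm X)) as (s1 & [A1 B1] & _).
{ rewrite comp_id_r; reflexivity. }
destruct (proj2 HP2 X (m ∘ x) (idm X)) as (s2 & [A2 B2] & _).
{ rewrite comp_id_r, comp_assoc; reflexivity. }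
destruct (proj2 HP2 P1 (m ∘ a1) b1) as (v & [Va Vb] & _).
{ rewrite comp_assoc; exact (proj1 HP1). }
assert (Hv : is_iso v).
{ apply (H5 K P1 X K P2 X k1 b1 s1 k2 b2 s2 (idm K) v (idm X)); auto.
  - rewrite comp_id_r; apply (pullback_jointly_monic HP2).
    + rewrite comp_assoc, Va, <- comp_assoc, Ek1, Ek2; reflexivity.
    + rewrite comp_assoc, Vb; apply zero_unique; [apply (proj1 Hk1) | apply (proj1 Hk2)].
  - rewrite comp_id_l; exact Vb.
  - rewrite comp_id_r; apply (pullback_jointly_monic HP2).
    + rewrite comp_assoc, Va, <- comp_assoc, A1, A2; reflexivity.
    + rewrite comp_assoc, Vb, B1, B2; reflexivity.
  - apply id_iso.
  - apply id_iso. }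
destruct Hv as (n & _ & Hn).
(* Since [v] is invertible with inverse [n], the projection [a2 = m ∘ (a1 ∘ n)] factors through [m];
   it is a regular epimorphism, as a pullback of [q ∘ m ∘ x]. *)
apply (@mono_iso_of_regular_epi _ _ _ _ m (a1 ∘ n) Hm).
rewrite comp_assoc, <- Va, <- comp_assoc, Hn, comp_id_r.
exact (Hst _ _ _ _ _ _ _ _ HP2 Hr).
Qed.

(** The quotient is the image of a map [f] with kernel [k]: dropping the mono part of [f] does not
    change the kernel, and a regular epimorphism is the cokernel of its kernel. *)
Lemma normal_mono_extension (C : Category) (K E : C) (k : Hom K E) :
  homological C -> normal_mono k ->
  exists (Q : C) (q : Hom E Q), short_exact k q.
Proof.
intros HC (Y & f & HK).
pose proof HC as (_ & (_ & Hfac & _) & _).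
destruct (Hfac _ _ f) as (I & p & m & Hp & Hm & ->).
assert (HKp : is_kernel k p).
{ destruct HK as [Hz Hu]; split.
  - destruct (zero_exists K I (proj1 HC)) as (z & Zz).
    replace (p ∘ k) with z; [exact Zz |].
    apply Hm, zero_unique; [apply zero_comp_l; exact Zz |].
    rewrite comp_assoc; exact Hz.
  - intros W g Hg; apply Hu.
    rewrite <- comp_assoc; apply zero_comp_l; exact Hg. }
exists I, p; split; [exact HKp |].
apply regular_epi_cokernel; auto.
Qed.

(** * Morphisms of extensions that are the identity on the quotient *)

Lemma ext_mor_id_pullback (C : Category) (K E Q K' E' : C) (k : Hom K E)
    (q : Hom E Q) (k' : Hom K' E') (q' : Hom E' Q) (u : Hom K K') (e : Hom E E') :
  is_kernel k q -> is_kernel k' q' -> is_ext_mor k q k' q' u e (idm Q) ->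
  is_pullback e k' k u.
Proof.
intros HK HK' [E1 E2]; rewrite comp_id_l in E2; split; [exact E1 |].
intros X a b Hab.
(* [q ∘ a = q' ∘ e ∘ a = q' ∘ k' ∘ b] is zero, so [a] factors through [k]. *)
destruct (proj2 HK X a) as (h & Hh & Hun).
{ rewrite <- E2, <- comp_assoc, Hab, comp_assoc; apply zero_comp_r, (proj1 HK'). }
exists h; repeat split.
- exact Hh.
- apply (kernel_mono HK').
  rewrite comp_assoc, <- E1, <- comp_assoc, Hh; exact Hab.
- intros h' [Eh' _]; auto.
Qed.

Lemma ext_mor_id_regular_epi (C : Category) (K E Q K' E' : C) (k : Hom K E)
    (q : Hom E Q) (k' : Hom K' E') (q' : Hom E' Q) (u : Hom K K') (e : Hom E E') :
  homological C -> short_exact k q -> is_kernel k' q' ->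
  is_ext_mor k q k' q' u e (idm Q) -> regular_epi u -> regular_epi e.
Proof.
intros HC [_ Hq] HK' [E1 E2] Hu; rewrite comp_id_l in E2.
pose proof HC as (Hpt & (_ & Hfac & _) & _).
destruct (Hfac _ _ e) as (I & p & m & Hp & Hm & ->).
rewrite <- comp_assoc in E1.
(* Because [u] is a regular epimorphism, [k'] factors through the image [m] of [e]. The image
   therefore contains the kernel of [q'], and [q' ∘ m ∘ p = q] shows that it covers [Q]. *)
destruct (regular_epi_lift Hu Hm E1) as (j & Ej & _).
rewrite comp_assoc in E2.
apply regular_epi_iso_comp; [| exact Hp].
apply (@mono_iso_of_kernel _ _ _ _ _ _ j m q' p HC Hm).
- rewrite Ej; exact HK'.
- rewrite E2; apply normal_epi_regular; [exact Hpt |].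
  exists K, k; exact Hq.
Qed.

Lemma ext_mor_id_pushout (C : Category) (K E Q K' E' : C) (k : Hom K E)
    (q : Hom E Q) (k' : Hom K' E') (q' : Hom E' Q) (u : Hom K K') (e : Hom E E') :
  homological C -> short_exact k q -> is_kernel k' q' ->
  is_ext_mor k q k' q' u e (idm Q) -> regular_epi u -> is_pushout k u e k'.
Proof.
intros HC HE HK' HM Hu.
pose proof (ext_mor_id_regular_epi HC HE HK' HM Hu) as He.
pose proof (ext_mor_id_pullback (proj1 HE) HK' HM) as HP.
pose proof HC as (Hpt & (Hfc & _) & _).
split; [exact (proj1 HM) |].
intros X a b Hab.
destruct (kernel_exists e Hpt Hfc) as (N & n & Hn).
destruct (zero_exists N K' Hpt) as (z & Zz).
(* The pullback lifts [(n, 0)] to [n'], so the kernel of [e] lies in [K] and is killed by [u]. Hence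
   [a ∘ n = b ∘ u ∘ n'] vanishes and [a] descends along [e]. *)
destruct (proj2 HP N n z) as (n' & [En1 En2] & _).
{ apply zero_unique; [exact (proj1 Hn) | apply zero_comp_l; exact Zz]. }
destruct (proj2 (regular_epi_cokernel HC He Hn) X a) as (h & Eh & Hh).
{ rewrite <- En1, comp_assoc, Hab, <- comp_assoc, En2; apply zero_comp_l; exact Zz. }
exists h; repeat split.
- exact Eh.
- apply (regular_epi_epi Hu).
  rewrite <- comp_assoc, <- (proj1 HM), comp_assoc, Eh; exact Hab.
- intros h' [Eh' _]; auto.
Qed.

(** * Pushouts along normal epimorphisms and the coaugmentation *)

Lemma pushout_normal_epi (C : Category) (S A B P : C) (f : Hom S A) (g : Hom S B)
    (i1 : Hom A P) (i2 : Hom B P) :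
  pointed C -> is_pushout f g i1 i2 -> normal_epi g -> normal_epi i1.
Proof.
intros Hpt [Hc Hu] Hg; pose proof Hg as (W & x & Hz & Hx).
(* If [g] is the cokernel of [x], then [i1] is the cokernel of [f ∘ x]. *)
exists W, (f ∘ x); split.
{ rewrite comp_assoc, Hc, <- comp_assoc; apply zero_comp_l; exact Hz. }
intros V a Ha; rewrite comp_assoc in Ha.
destruct (Hx V (a ∘ f) Ha) as (b & Eb & Hb).
destruct (Hu V a b (eq_sym Eb)) as (h & [E1 E2] & Hh).
exists h; split; [exact E1 |].
intros h' E'; apply Hh; split; [exact E' |].
symmetry; apply Hb.
rewrite <- comp_assoc, <- Hc, comp_assoc, E'; reflexivity.
Qed.

(** Covering [W] by the pullback of [e] along [k' ∘ a] lifts [a] and [b] to maps into [K] with the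
    same component [g] in [E]. These agree because [k] is monic, and the cover [r] is an
    epimorphism. *)
Lemma regular_epi_pullback_mono (C : Category) (K E K' E' : C) (k : Hom K E)
    (u : Hom K K') (e : Hom E E') (k' : Hom K' E') :
  regular C -> is_pullback e k' k u -> regular_epi e -> is_mono k -> is_mono k'.
Proof.
intros (Hfc & _ & Hst) HP He Hk W a b Hab.
destruct (pullback_exists (k' ∘ a) e Hfc) as (V & r & g & HV).
pose proof (Hst _ _ _ _ _ _ _ _ HV He) as Hr.
pose proof (proj1 HV) as Ev.
destruct (proj2 HP V g (a ∘ r)) as (h1 & [F1 G1] & _).
{ rewrite comp_assoc; auto. }
destruct (proj2 HP V g (b ∘ r)) as (h2 & [F2 G2] & _).
{ rewrite comp_assoc, <- Hab; auto. }
apply (regular_epi_epi Hr).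
rewrite <- G1, <- G2; f_equal; apply Hk; rewrite F1, F2; reflexivity.
Qed.

(* The map [E' -> Q] induced by [q] and [0] shows that [E] and [K'] meet in [K]. *)
Lemma pushout_mono_pullback (C : Category) (K E Q K' E' : C) (k : Hom K E)
    (q : Hom E Q) (u : Hom K K') (e : Hom E E') (k' : Hom K' E') :
  pointed C -> is_kernel k q -> is_pushout k u e k' -> is_mono k' ->
  is_pullback e k' k u.
Proof.
intros Hpt HK HP Hk'; split; [exact (proj1 HP) |].
destruct (zero_exists K' Q Hpt) as (z & Zz).
destruct (proj2 HP Q q z) as (q' & [Q1 Q2] & _).
{ apply zero_unique; [exact (proj1 HK) | apply zero_comp_r; exact Zz]. }
intros X a b Hab.
destruct (proj2 HK X a) as (h & Hh & Hun).
{ rewrite <- Q1, <- comp_assoc, Hab, comp_assoc, Q2; apply zero_comp_r; exact Zz. }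
exists h; repeat split.
- exact Hh.
- apply Hk'; rewrite comp_assoc, <- (proj1 HP), <- comp_assoc, Hh; exact Hab.
- intros h' [Eh' _]; auto.
Qed.

(** For the kernel, a map [g] killed by [q'] is covered by a map [g'] into [E] killed by [q], hence
    lying in [K]; its image under [u] descends along the cover [r] because [k'] is monic. The
    cokernel property is inherited from [q] since [e] is epic. *)
Lemma pushout_mono_short_exact (C : Category) (K E Q K' E' : C) (k : Hom K E)
    (q : Hom E Q) (u : Hom K K') (e : Hom E E') (k' : Hom K' E') (q' : Hom E' Q) :
  regular C -> short_exact k q -> e ∘ k = k' ∘ u -> regular_epi e -> is_mono k' ->
  q' ∘ e = q -> is_zero (q' ∘ k') -> short_exact k' q'.
Proof.
intros (Hfc & _ & Hst) [HK HQ] Hc He Hk' Eq Zq; split; split; auto.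
- intros W g Hg.
  destruct (pullback_exists g e Hfc) as (V & r & g' & HV).
  pose proof (Hst _ _ _ _ _ _ _ _ HV He) as Hr.
  pose proof (proj1 HV) as Ev.
  destruct (proj2 HK V g') as (h & Hh & _).
  { rewrite <- Eq, <- comp_assoc, <- Ev, comp_assoc; apply zero_comp_r; exact Hg. }
  destruct (@regular_epi_lift _ _ _ _ _ r k' (u ∘ h) g Hr Hk') as (t & Ht & _).
  { rewrite comp_assoc, <- Hc, <- comp_assoc, Hh; auto. }
  exists t; split; [exact Ht |].
  intros t' Ht'; apply Hk'; rewrite Ht, Ht'; reflexivity.
- intros W g Hg.
  destruct (proj2 HQ W (g ∘ e)) as (h & Hh & Hun).
  { rewrite <- comp_assoc, Hc, comp_assoc; apply zero_comp_r; exact Hg. }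
  exists h; split.
  + apply (regular_epi_epi He); rewrite <- comp_assoc, Eq; exact Hh.
  + intros h' <-; apply Hun; rewrite <- comp_assoc, Eq; reflexivity.
Qed.

(* A map from [K] to a local object extends along [coaug L K]; applied to
   [coaug L E ∘ k] this extends [coaug L E] along [e]. *)
Lemma pushout_coaug_inverted (C : Category) (L : LocalizationFunctor C) (K E E' : C)
    (k : Hom K E) (e : Hom E E') (k' : Hom (L K) E') :
  (forall X : C, is_epi (coaug L X)) -> is_epi e ->
  is_pushout k (coaug L K) e k' -> is_iso (fmap L e).
Proof.
intros Heta He [_ Hu].
destruct (loc_coaug_iso L E) as (n & Hn1 & Hn2).
rewrite loc_coaug in Hn1, Hn2.
destruct (Hu (L E) (coaug L E) (n ∘ fmap L (coaug L E ∘ k))) as (t & [Ht _] & _).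
{ rewrite <- comp_assoc, <- coaug_natural, !comp_assoc, Hn1, comp_id_l; reflexivity. }
(* [n] inverts [coaug L (L E)], and [t ∘ e = coaug L E], so this is a left inverse. The other
   equation is tested by precomposing with [coaug L E'] and then with [e], both epic. *)
exists (n ∘ fmap L t); split.
{ rewrite <- comp_assoc, <- fmap_comp, Ht, loc_coaug; exact Hn1. }
apply Heta.
rewrite <- !comp_assoc, <- coaug_natural, (comp_assoc n), Hn1, !comp_id_l.
apply He; rewrite <- comp_assoc, Ht, coaug_natural; reflexivity.
Qed.

(** * Functorial fiberwise localization from pushouts *)

Lemma fiberwise_localization_pushout (C : Category) (L : LocalizationFunctor C)
    (X : Extension C) :
  homological C -> (forall Y : C, normal_epi (coaug L Y)) ->
  pushouts_exist_with_mono L ->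
  exists F : FiberwiseLocalization L X,
    is_pushout (extk X) (coaug L (extK X)) (fle F) (flk F) /\ is_epi (fle F).
Proof.
intros (Hpt & Hreg & _) Heta H2.
pose proof (ext_exact X) as HX; pose proof HX as [HK HQ].
destruct (H2 _ _ (extk X)) as (E' & e & k' & HP & Hk').
{ exists (extQ X), (extq X); exact HK. }
pose proof (normal_epi_regular Hpt (pushout_normal_epi Hpt HP (Heta _))) as He.
destruct (zero_exists (L (extK X)) (extQ X) Hpt) as (z & Zz).
(* The new quotient map is induced by the old one on [E] and zero on [L K]. *)
destruct (proj2 HP _ (extq X) z) as (q' & [Q1 Q2] & _).
{ apply zero_unique; [exact (proj1 HK) | apply zero_comp_r; exact Zz]. }
assert (Hex : short_exact k' q').
{ apply (pushout_mono_short_exact Hreg HX (proj1 HP) He Hk' Q1).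
  rewrite Q2; exact Zz. }
assert (Hinv : is_iso (fmap L e)).
{ apply (fun H => pushout_coaug_inverted H (regular_epi_epi He) HP).
  intros Y; apply regular_epi_epi, normal_epi_regular; auto. }
assert (Hm : is_ext_mor (extk X) (extq X) k' q' (coaug L (extK X)) e
               (idm (extQ X))).
{ split; [exact (proj1 HP) | rewrite comp_id_l; exact Q1]. }
exists {| fl_exact := Hex; fl_inverted := Hinv; fl_comm := Hm |}.
split; [exact HP | exact (regular_epi_epi He)].
Qed.

(** Naturality of the coaugmentation gives the cocone that induces [v]; compatibility with the
    quotients is checked after precomposing with the epimorphism [fle F]. *)
Lemma fiberwise_localization_mor (C : Category) (L : LocalizationFunctor C)
    (X Y : Extension C) (F : FiberwiseLocalization L X)
    (G : FiberwiseLocalization L Y) (f : ExtMor X Y) :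
  is_pushout (extk X) (coaug L (extK X)) (fle F) (flk F) -> is_epi (fle F) ->
  exists v : Hom (flE F) (flE G),
    is_ext_mor (flk F) (flq F) (flk G) (flq G) (fmap L (mor_u f)) v (mor_w f) /\
    v ∘ fle F = fle G ∘ mor_v f.
Proof.
intros HP He.
destruct (mor_comm f) as [f1 f2].
destruct (fl_comm F) as [_ F2], (fl_comm G) as [G1 G2].
rewrite comp_id_l in F2, G2.
destruct (proj2 HP _ (fle G ∘ mor_v f) (flk G ∘ fmap L (mor_u f)))
  as (v & [E1 E2] & _).
{ rewrite <- !comp_assoc, f1, <- coaug_natural, !comp_assoc, G1; reflexivity. }
exists v; repeat split; auto.
apply He.
rewrite <- !comp_assoc, E1, F2, comp_assoc, G2; exact f2.
Qed.

(** Localizations and induced maps are picked by choice. Functoriality survives arbitrary choices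
    because [fle] is epic, so each map is determined by its composite with [fle]. *)
Lemma pushouts_with_mono_functorial (C : Category) (L : LocalizationFunctor C) :
  homological C -> (forall Y : C, normal_epi (coaug L Y)) ->
  pushouts_exist_with_mono L -> admits_functorial_fiberwise_localization L.
Proof.
intros HC Heta H2.
pose (F := fun X => constructive_indefinite_description _
  (fiberwise_localization_pushout X HC Heta H2)).
pose (V := fun X Y f => constructive_indefinite_description _
  (fiberwise_localization_mor (proj1_sig (F Y)) f
     (proj1 (proj2_sig (F X))) (proj2 (proj2_sig (F X))))).
constructor.
refine {| ffl := fun X => proj1_sig (F X);
          ffl_map := fun X Y f => proj1_sig (V X Y f) |}.
- intros X Y f; exact (proj1 (proj2_sig (V X Y f))).
- intros X Y f; exact (proj2 (proj2_sig (V X Y f))).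
- intros X; apply (proj2 (proj2_sig (F X))).
  rewrite (proj2 (proj2_sig (V X X (ext_id X)))); simpl.
  rewrite comp_id_l, comp_id_r; reflexivity.
- intros X Y Z g f; apply (proj2 (proj2_sig (F X))).
  rewrite (proj2 (proj2_sig (V X Z (ext_comp g f)))), <- comp_assoc,
    (proj2 (proj2_sig (V X Y f))), comp_assoc, (proj2 (proj2_sig (V Y Z g))).
  simpl; rewrite comp_assoc; reflexivity.
Qed.

(** * Pushouts from fiberwise localization, and the equivalences *)

Lemma functorial_pushouts_pullbacks (C : Category) (L : LocalizationFunctor C) :
  homological C -> (forall Y : C, normal_epi (coaug L Y)) ->
  admits_functorial_fiberwise_localization L -> pushouts_exist_and_are_pullbacks L.
Proof.
intros HC Heta [F] K E k Hk.
destruct (normal_mono_extension HC Hk) as (Q & q & Hex).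
pose (X := {| ext_exact := Hex |}).
exists (flE (ffl F X)), (fle (ffl F X)), (flk (ffl F X)).
pose proof (fl_exact (ffl F X)) as [HK' _].
pose proof (fl_comm (ffl F X)) as HM.
split.
- apply (ext_mor_id_pushout HC Hex HK' HM).
  apply normal_epi_regular; [exact (proj1 HC) | apply Heta].
- exact (ext_mor_id_pullback (proj1 Hex) HK' HM).
Qed.

Theorem proposition3p5 (C : Category) (HC : homological C)
    (L : LocalizationFunctor C)
    (Heta : forall X : C, normal_epi (coaug L X)) :
  (admits_functorial_fiberwise_localization L <-> pushouts_exist_and_are_pullbacks L) /\
  (pushouts_exist_and_are_pullbacks L <-> pushouts_exist_with_mono L).
Proof.
pose proof HC as (Hpt & Hreg & _).
assert (H12 : pushouts_exist_and_are_pullbacks L -> pushouts_exist_with_mono L).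
{ intros H1 K E k Hk.
  destruct (H1 K E k Hk) as (E' & e & k' & HPo & HPb).
  exists E', e, k'; split; [exact HPo |].
  (* [e] is a normal epimorphism, as a pushout of [coaug L K], so monicity passes from [k] to [k']
     across the pullback square. *)
  apply (regular_epi_pullback_mono Hreg HPb).
  - exact (normal_epi_regular Hpt (pushout_normal_epi Hpt HPo (Heta _))).
  - destruct Hk as (Y & f & HK); exact (kernel_mono HK). }
(* [H12] settles (1) to (2), and also lets (1) to (0) pass through (2). *)
split; split; auto.
- apply functorial_pushouts_pullbacks; auto.
- intros H1; apply pushouts_with_mono_functorial; auto.
- intros H2 K E k Hk.
  destruct (H2 K E k Hk) as (E' & e & k' & HPo & Hm).
  exists E', e, k'; split; [exact HPo |].
  destruct Hk as (Y & f & HK).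
  exact (pushout_mono_pullback Hpt HK HPo Hm).
Qed.
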